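(* Let $Q$ be a cyclic quadrilateral circumscribed about a central conic $\mathcal D$. Assume that the circumcenter of $Q$ coincides with a focus of $\mathcal D$. Then $Q$ is orthodiagonal.
   Context: A central conic is an ellipse or a hyperbola. A quadrilateral with vertices $z_1,z_2,z_3,z_4$ (in this order) is circumscribed about a conic if the four side lines $z_1z_2,z_2z_3,z_3z_4,z_4z_1$ are tangent to the conic; the quadrilateral need not be convex. It is orthodiagonal if its diagonals, i.e. the lines $z_1z_3$ and $z_2z_4$, are perpendicular. *)

(* Defs.v *)
From mathcomp Require Import all_boot all_order all_algebra.
From mathcomp Require Import complex.
From mathcomp Require Import reals.

Set Implicit Arguments.
Unset Strict Implicit.
Unset Printing Implicit Defensive.

Import Order.TTheory GRing.Theory Num.Theory.
Local Open Scope ring_scope.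
Local Open Scope complex_scope.

(* The Euclidean plane is R[i]; since the codomain of `|z| is R[i], real
   lengths are embedded by _%:C. *)

Inductive conic_kind := Ellipse | Hyperbola.

(* In the orthonormal frame with origin [center] and first axis the unit
   vector [axis], the conic has the equation
     x^2/a^2 + y^2/b^2 = 1  (ellipse)  or  x^2/a^2 - y^2/b^2 = 1  (hyperbola).
   For an ellipse [axis] directs the major axis; a = b is a circle. *)
Record central_conic (R : realType) := CentralConic {
  kind : conic_kind;
  center : R[i];
  axis : R[i];
  semi_a : R;
  semi_b : R;
  axis_unit : `|axis| = 1;
  semi_a_gt0 : 0 < semi_a;
  semi_b_gt0 : 0 < semi_b;
  ellipse_axes : kind = Ellipse -> semi_b <= semi_a
}.

Section CentralConic.
Variables (R : realType) (D : central_conic R).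

Definition frame_coord (z : R[i]) : R[i] := (z - center D) * (axis D)^*.

(* The left-hand side minus the right-hand side of the equation of D. *)
Definition conic_eqn (z : R[i]) : R :=
  let X2 := (complex.Re (frame_coord z) / semi_a D) ^+ 2 in
  let Y2 := (complex.Im (frame_coord z) / semi_b D) ^+ 2 in
  match kind D with
  | Ellipse => X2 + Y2 - 1
  | Hyperbola => X2 - Y2 - 1
  end.

Definition focal_distance : R :=
  match kind D with
  | Ellipse => Num.sqrt (semi_a D ^+ 2 - semi_b D ^+ 2)
  | Hyperbola => Num.sqrt (semi_a D ^+ 2 + semi_b D ^+ 2)
  end.

Definition is_focus (f : R[i]) : Prop :=
  f = center D + focal_distance%:C * axis D \/
  f = center D - focal_distance%:C * axis D.

Definition line_point (z w : R[i]) (t : R) : R[i] := z + t%:C * (w - z).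

(* The line zw is tangent to D when it meets D in a double point: the equation
   of D, of degree 2, restricts to the line as k (t - t0)^2 (double point at
   parameter t0) or as a constant k (double point at infinity).  The second
   case occurs only for the asymptotes of a hyperbola, its tangents at
   infinity. *)
Definition tangent_line (z w : R[i]) : Prop :=
  z != w /\
  exists k : R,
    (exists t0 : R, forall t : R,
       conic_eqn (line_point z w t) = k * (t - t0) ^+ 2) \/
    (forall t : R, conic_eqn (line_point z w t) = k).

Definition circumscribed (z1 z2 z3 z4 : R[i]) : Prop :=
  [/\ tangent_line z1 z2, tangent_line z2 z3,
      tangent_line z3 z4 & tangent_line z4 z1].

End CentralConic.

Section Quadrilateral.
Variable R : realType.

Definition is_circumcenter (o z1 z2 z3 z4 : R[i]) : Prop :=
  exists r : R, [/\ `|z1 - o| = r%:C, `|z2 - o| = r%:C,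
                    `|z3 - o| = r%:C & `|z4 - o| = r%:C].

Definition cyclic_quad (z1 z2 z3 z4 : R[i]) : Prop :=
  uniq [:: z1; z2; z3; z4] /\ exists o : R[i], is_circumcenter o z1 z2 z3 z4.

Definition perpendicular (u v : R[i]) : Prop := complex.Re (u * v^*) = 0.

Definition orthodiagonal (z1 z2 z3 z4 : R[i]) : Prop :=
  perpendicular (z3 - z1) (z4 - z2).

End Quadrilateral.

(* Main.v *)
Require Import Defs.
From mathcomp Require Import all_boot all_order all_algebra.
From mathcomp Require Import complex.
From mathcomp Require Import reals.
From mathcomp Require Import ring lra.

Set Implicit Arguments.
Unset Strict Implicit.
Unset Printing Implicit Defensive.

Import Order.TTheory GRing.Theory Num.Theory.
Local Open Scope ring_scope.
Local Open Scope complex_scope.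

(** The foot of the perpendicular from a focus to a tangent lies on the
    auxiliary circle, which has the center of the conic and radius [semi_a]
    (an asymptote counts as a tangent here).  Since the circumcenter is a
    focus, the feet on the sides are their midpoints.  The midpoints form a
    parallelogram with diagonal vectors [p], [q] such that [p + q = z2 - z4]
    and [p - q = z1 - z3].  A parallelogram inscribed in a circle has
    [|p| = |q|], so [p + q] and [p - q] are perpendicular. *)

Definition normsq {R : realType} (z : R[i]) : R :=
  complex.Re z ^+ 2 + complex.Im z ^+ 2.

Lemma normsq_norm (R : realType) (z : R[i]) (r : R) :
  `|z| = r%:C -> normsq z = r ^+ 2.
Proof.
by move=> zr; apply: complexI; rewrite add_Re2_Im2 zr rmorphXn.
Qed.

(** With this sign [s], both kinds of conic have the equation [x^2/a^2 + s y^2/b^2 = 1], so one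
    computation serves for both. *)
Definition conic_sign {R : realType} (D : central_conic R) : R :=
  if kind D is Ellipse then 1 else -1.

Lemma conic_sign_sqr (R : realType) (D : central_conic R) :
  conic_sign D ^+ 2 = 1.
Proof. by rewrite /conic_sign; case: (kind D); rewrite ?sqrrN expr1n. Qed.

Lemma conic_eqnE (R : realType) (D : central_conic R) (z : R[i]) :
  conic_eqn D z = (complex.Re (frame_coord D z) / semi_a D) ^+ 2
    + conic_sign D * (complex.Im (frame_coord D z) / semi_b D) ^+ 2 - 1.
Proof.
by rewrite /conic_eqn /conic_sign; case: (kind D); rewrite ?mul1r ?mulN1r.
Qed.

Lemma focal_distance_sqr (R : realType) (D : central_conic R) :
  focal_distance D ^+ 2 = semi_a D ^+ 2 - conic_sign D * semi_b D ^+ 2.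
Proof.
have a0 := semi_a_gt0 D; have b0 := semi_b_gt0 D.
rewrite /focal_distance /conic_sign; case Dk: (kind D).
- rewrite mul1r sqr_sqrtr // subr_ge0 ler_sqr ?nnegrE ?(ltW a0) ?(ltW b0) //.
  exact: ellipse_axes Dk.
- by rewrite mulN1r opprK sqr_sqrtr // addr_ge0 ?sqr_ge0.
Qed.

Lemma double_root_discriminant (R : realType) (A B C k : R) :
  (exists t0 : R, forall t : R,
     A * t ^+ 2 + 2 * B * t + C = k * (t - t0) ^+ 2) \/
  (forall t : R, A * t ^+ 2 + 2 * B * t + C = k) ->
  B ^+ 2 = A * C.
Proof.
(* Three values determine the coefficients of a polynomial of degree at most 2. *)
move=> [[t0 H]|H]; move: (H 0) (H 1) (H (-1)) => H0 H1 H2.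
- have -> : C = k * t0 ^+ 2 by lra.
  have -> : A = k by lra.
  have -> : B = - (k * t0) by lra.
  ring.
- have -> : A = 0 by lra.
  have -> : B = 0 by lra.
  ring.
Qed.

(* [u] is a point of the line, [v] its direction, [s] the sign of the conic. *)
Lemma tangency_condition (R : realType) (a b s u1 u2 v1 v2 : R) :
  a != 0 -> b != 0 -> s ^+ 2 = 1 ->
  (u1 * v1 / a ^+ 2 + s * (u2 * v2) / b ^+ 2) ^+ 2 =
    (v1 ^+ 2 / a ^+ 2 + s * v2 ^+ 2 / b ^+ 2) *
    (u1 ^+ 2 / a ^+ 2 + s * u2 ^+ 2 / b ^+ 2 - 1) ->
  (u1 * v2 - u2 * v1) ^+ 2 = s * b ^+ 2 * v1 ^+ 2 + a ^+ 2 * v2 ^+ 2.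
Proof.
move=> a0 b0 s2.
move=> /eqP; rewrite -subr_eq0 => /eqP H.
apply/eqP; rewrite -subr_eq0; apply/eqP.
(* By Lagrange's identity the discriminant is [v1^2/a^2 + s v2^2/b^2 - s (u1 v2 - u2 v1)^2 / (a^2
   b^2)]; this factor clears denominators, as [s^2 = 1]. *)
transitivity (- (s * a ^+ 2 * b ^+ 2) *
  ((u1 * v1 / a ^+ 2 + s * (u2 * v2) / b ^+ 2) ^+ 2 -
    (v1 ^+ 2 / a ^+ 2 + s * v2 ^+ 2 / b ^+ 2) *
    (u1 ^+ 2 / a ^+ 2 + s * u2 ^+ 2 / b ^+ 2 - 1))).
  field: s2; by rewrite ?a0 ?b0.
by rewrite H mulr0.
Qed.

(* [n] is the point of the line closest to the focus [(f, 0)]; Lagrange's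
   identity computes [|n|] from [n . v] and [n x v]. *)
Lemma pedal_point_on_auxiliary_circle (R : realDomainType)
    (a b s f n1 n2 v1 v2 : R) :
  (v1 != 0) || (v2 != 0) ->
  f ^+ 2 = a ^+ 2 - s * b ^+ 2 ->
  (n1 - f) * v1 + n2 * v2 = 0 ->
  (n1 * v2 - n2 * v1) ^+ 2 = s * b ^+ 2 * v1 ^+ 2 + a ^+ 2 * v2 ^+ 2 ->
  n1 ^+ 2 + n2 ^+ 2 = a ^+ 2.
Proof.
move=> v0 f2 orth tangent.
have v20 : v1 ^+ 2 + v2 ^+ 2 != 0.
  by rewrite paddr_eq0 ?sqr_ge0 // !sqrf_eq0 negb_and.
have dot : n1 * v1 + n2 * v2 = f * v1.
  by apply/eqP; rewrite -subr_eq0 -orth; apply/eqP; ring.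
apply: (mulIf v20).
transitivity ((n1 * v1 + n2 * v2) ^+ 2 + (n1 * v2 - n2 * v1) ^+ 2); first ring.
(* The terms [s b^2 v1^2] cancel, leaving [a^2 (v1^2 + v2^2)]. *)
by rewrite tangent dot exprMn f2; ring.
Qed.

Lemma normsq_eq0 (R : realType) (z : R[i]) : (normsq z == 0) = (z == 0).
Proof.
by rewrite /normsq paddr_eq0 ?sqr_ge0 // !sqrf_eq0 eq_complex.
Qed.

Lemma normsq_axis (R : realType) (D : central_conic R) : normsq (axis D) = 1.
Proof. by rewrite (@normsq_norm _ _ 1) ?expr1n // axis_unit. Qed.

Lemma normsq_mul_axis (R : realType) (D : central_conic R) (z : R[i]) :
  normsq (z * (axis D)^*) = normsq z.
Proof.
have := normsq_axis D; case: (axis D) z => p q [x y]; rewrite /normsq /= => pq.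
by rewrite -[RHS]mulr1 -pq; ring.
Qed.

Lemma frame_coordB (R : realType) (D : central_conic R) (z w : R[i]) :
  frame_coord D z - frame_coord D w = (z - w) * (axis D)^*.
Proof. by rewrite /frame_coord; ring. Qed.

Lemma frame_coord_line (R : realType) (D : central_conic R) (z w : R[i])
    (t : R) :
  frame_coord D (line_point z w t) =
  line_point (frame_coord D z) (frame_coord D w) t.
Proof. by rewrite /line_point /frame_coord; ring. Qed.

Lemma axis_conj_mul (R : realType) (D : central_conic R) :
  axis D * (axis D)^* = 1.
Proof.
have := normsq_axis D; case: (axis D) => p q; rewrite /normsq /= => pq.
by apply/eqP; rewrite eq_complex /= -pq; apply/andP; split; apply/eqP; ring.
Qed.

(** The sign of [f] tells the two foci apart; only [f^2] matters later. *)
Lemma frame_coord_focus (R : realType) (D : central_conic R) (o : R[i]) :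
  is_focus D o ->
  exists2 f : R, frame_coord D o = f%:C & f ^+ 2 = focal_distance D ^+ 2.
Proof.
rewrite /frame_coord => -[] ->.
- exists (focal_distance D) => //.
  by rewrite addrAC subrr add0r -mulrA axis_conj_mul mulr1.
- exists (- focal_distance D); last by rewrite sqrrN.
  by rewrite addrAC subrr add0r mulNr -mulrA axis_conj_mul mulr1 rmorphN.
Qed.

Lemma tangent_line_frame (R : realType) (D : central_conic R) (z w : R[i]) :
  tangent_line D z w ->
  let u1 := complex.Re (frame_coord D z) in
  let u2 := complex.Im (frame_coord D z) in
  let v1 := complex.Re (frame_coord D w) - u1 in
  let v2 := complex.Im (frame_coord D w) - u2 in
  (u1 * v2 - u2 * v1) ^+ 2 =
    conic_sign D * semi_b D ^+ 2 * v1 ^+ 2 + semi_a D ^+ 2 * v2 ^+ 2.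
Proof.
move=> [_ [k tangent]] u1 u2 v1 v2.
have a0 : semi_a D != 0 by rewrite gt_eqF ?semi_a_gt0.
have b0 : semi_b D != 0 by rewrite gt_eqF ?semi_b_gt0.
apply: tangency_condition => //; first exact: conic_sign_sqr.
set A := v1 ^+ 2 / _ + _; set B := u1 * v1 / _ + _; set C := _ - 1.
have quadratic t :
    conic_eqn D (line_point z w t) = A * t ^+ 2 + 2 * B * t + C.
  rewrite conic_eqnE frame_coord_line /A /B /C /v1 /v2 /u1 /u2.
  case: (frame_coord D z) (frame_coord D w) => x1 y1 [x2 y2] /=.
  by field; rewrite ?a0 ?b0.
apply: (@double_root_discriminant _ A B C k).
case: tangent => [[t0 H]|H]; [left; exists t0|right] => t;
  by rewrite -quadratic H.
Qed.

(** A focus equidistant from [z] and [w] projects onto their line at the midpoint. The sum of the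
    two vectors is twice that midpoint seen from the center, whence the factor 4. *)
Lemma chord_midpoint_on_auxiliary_circle (R : realType) (D : central_conic R)
    (z w o : R[i]) :
  is_focus D o -> tangent_line D z w -> normsq (z - o) = normsq (w - o) ->
  normsq ((z - center D) + (w - center D)) = 4 * semi_a D ^+ 2.
Proof.
move=> /frame_coord_focus[f oE f2] zw.
rewrite -(normsq_mul_axis D (z - o)) -(normsq_mul_axis D (w - o)).
rewrite -!frame_coordB oE -(normsq_mul_axis D (z - center D + _)) mulrDl.
rewrite -/(frame_coord D z) -/(frame_coord D w).
have := tangent_line_frame zw.
have : normsq (frame_coord D w - frame_coord D z) != 0.
  by rewrite frame_coordB normsq_mul_axis normsq_eq0 subr_eq0 eq_sym; case: zw.
rewrite focal_distance_sqr in f2.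
case: (frame_coord D z) (frame_coord D w) => u1 u2 [w1 w2].
rewrite normsq_eq0 eq_complex negb_and /normsq /= => v0 tangent dist.
have := @pedal_point_on_auxiliary_circle _ (semi_a D) (semi_b D)
  (conic_sign D) f ((u1 + w1) / 2) ((u2 + w2) / 2) (w1 - u1) (w2 - u2) v0 f2.
move=> H; rewrite -H.
- by field.
(* Equal distances make the median from the focus orthogonal to the chord. *)
- lra.
(* The cross product with the direction is the same at every point of the line. *)
- by rewrite -tangent; field.
Qed.

Theorem theorem4p6 (R : realType) (D : central_conic R)
    (z1 z2 z3 z4 o : R[i])
    (Hcyclic : cyclic_quad z1 z2 z3 z4)
    (Hcirc : circumscribed D z1 z2 z3 z4)
    (Hcenter : is_circumcenter o z1 z2 z3 z4)
    (Hfocus : is_focus D o) :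
  orthodiagonal z1 z2 z3 z4.
Proof.
case: Hcenter => r [/normsq_norm r1 /normsq_norm r2 /normsq_norm r3
  /normsq_norm r4].
case: Hcirc => t12 t23 t34 t41.
have M := chord_midpoint_on_auxiliary_circle Hfocus.
have := M _ _ t12 (etrans r1 (esym r2)).
have := M _ _ t23 (etrans r2 (esym r3)).
have := M _ _ t34 (etrans r3 (esym r4)).
have := M _ _ t41 (etrans r4 (esym r1)).
rewrite /orthodiagonal /perpendicular.
case: z1 z2 z3 z4 (center D) {Hcyclic t12 t23 t34 t41 r1 r2 r3 r4}
  => [x1 y1] [x2 y2] [x3 y3] [x4 y4] [c d]; rewrite /normsq /=.
(* The alternating sum of the four equations cancels all squares [|z_i - c|^2] and leaves twice the
   dot product of the diagonals. *)
lra.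
Qed.
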